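(* Let $L>2$. Under Assumptions (A1)–(A4) (stated in the context), there exists a universal constant $C>0$ such that for all $n\ge N(d,t_0,\tilde\theta,\delta_0,\eta_0)$, $$ P\left(h(\widehat\pi_n,\pi_0)>L\,\frac{(\log(nd))^{1+d/2}}{\sqrt n}\right)\le \frac{1}{(L^2/2-2)^2(\log(nd))^{2+d}}+\frac{C}{L}\,\frac{d\,3^{d}}{(\log(1/t_0))^{1+d/2}}\left(1+\frac{1}{(\log(1/t_0))^{1+d/2}}\right). $$ In particular, $h(\widehat\pi_n,\pi_0)=O_{\mathbb P}\big((\log(nd))^{1+d/2}/\sqrt n\big)$.
   Context: Power series distributions (PSDs): let $b_k\ge0$ with $b_k>0$ for every $k\in\mathbb N=\{0,1,2,\dots\}$, and $b(\theta)=\sum_{k\ge0}b_k\theta^k$ with radius of convergence $R\in(0,\infty]$. Let $\mathcal T=[0,R]$ if $b(R)<\infty$ and $\mathcal T=[0,R)$ if $b(R)=\infty$ (so $\mathcal T=[0,\infty)$ if $R=\infty$). For $\theta\in\mathcal T$, $f_\theta(k)=b_k\theta^k/b(\theta)$, $k\in\mathbb N$. Fix a dimension $d\ge1$ and let $\Theta=\mathcal T^d$. The true pmf on $\mathbb N^d$ is $\pi_0(\mathbf k)=\int_\Theta\prod_{j=1}^d f_{\theta_j}(k_j)\,dQ_0(\theta_1,\dots,\theta_d)$, $\mathbf k=(k_1,\dots,k_d)$, where $Q_0$ is an unknown probability measure on $\Theta$. Let $\mathbf X_1,\dots,\mathbf X_n$ be i.i.d. with pmf $\pi_0$. The nonparametric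 MLE $\widehat Q_n$ is a maximizer over all probability measures $Q$ on $\Theta$ of $\prod_{i=1}^n\int_\Theta\prod_{j=1}^d f_{\theta_j}(X_{ij})\,dQ(\boldsymbol\theta)$, and $\widehat\pi_n(\mathbf k)=\int_\Theta\prod_{j}f_{\theta_j}(k_j)\,d\widehat Q_n(\boldsymbol\theta)$. Hellinger distance: $h^2(\pi_1,\pi_2)=\frac12\sum_{\mathbf k\in\mathbb N^d}(\sqrt{\pi_1(\mathbf k)}-\sqrt{\pi_2(\mathbf k)})^2$. Assumptions: (A1) If $R<\infty$, there is $q_0\in(0,1)$ with $\mathrm{supp}\,Q_0\subseteq[0,q_0R]^d$; if $R=\infty$, there is $M>0$ with $\mathrm{supp}\,Q_0\subseteq[0,M]^d$. (A2) If $Q_0(\{(0,\dots,0)\})>0$, there exist $\eta_0\in(0,1)$ and $\delta_0\in(0,R)$ with $Q_0(\{(0,\dots,0)\})\le1-\eta_0$ and $\mathrm{supp}\,Q_0\cap\bigcup_{j=1}^d\{\boldsymbol\theta:\theta_j\in(0,\delta_0)\}=\varnothing$; if $Q_0(\{(0,\dots,0)\})=0$, there is $\delta_0\in(0,R)$ with $\mathrm{supp}\,Q_0\cap\bigcup_{j=1}^d\{\boldsymbol\theta:\theta_j\in(0,\delta_0)\}=\varnothing$ (in this case $\eta_0$ denotes an arbitrary fixed number in $(0,1]$). (A3) There is $V\in\mathbb N$ with $b_k/b_0\ge k^{-k}$ for all $k\ge V$. (A4) $\lim_{k\to\infty}b_{k+1}/b_k$ exists in $[0,\infty)$. Constants: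 $t_0=\frac{q_0+1}{2}$ and $\tilde\theta=q_0R$ if $R<\infty$; $t_0=\frac12$ and $\tilde\theta=M$ if $R=\infty$. $U=\lfloor\tilde\theta\sup_{\theta\in(0,\tilde\theta)}b'(\theta)/b(\theta)\rfloor+1$, $W=\min\{w\ge3:\sup_{k\ge w}b_{k+1}/b_k\le t_0/\tilde\theta\}$, and $N(d,t_0,\tilde\theta,\delta_0,\eta_0)=\Big\lfloor\frac1d\exp\Big\{\log\big(\tfrac{1}{\sqrt{t_0}}\big)\cdot\Big(U\vee V\vee W\vee\frac{b(\delta_0)}{b_0\eta_0^{1/d}}\vee\frac{1}{\delta_0^{1/d}}\Big)\Big\}\vee\frac{1}{t_0^{W-1}(1-t_0)}\Big\rfloor+1.$ *)

(* Defs.v *)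
From HB Require Import structures.
From mathcomp Require Import all_boot all_order all_algebra.
From mathcomp Require Import all_classical all_reals all_analysis.
From mathcomp Require Export Rstruct Rstruct_topology.
Unset Printing Implicit Defensive.
Import Order.TTheory GRing.Theory Num.Theory.
Import numFieldNormedType.Exports.
Local Open Scope classical_set_scope.
Local Open Scope ring_scope.

Section PSD.
Context {R : realType}.

Definition bfun (b : nat -> R) (th : R) : R := limn (series (fun k => b k * th ^+ k)).

Definition Tset (b : nat -> R) : set R :=
  [set th | 0 <= th /\ cvgn (series (fun k => b k * th ^+ k))].

Definition conv_radius (b : nat -> R) : \bar R := ereal_sup [set th%:E | th in Tset b].

Definition fpsd (b : nat -> R) (th : R) (k : nat) : R := b k * th ^+ k / bfun b th.

Definition Theta (b : nat -> R) (d : nat) : set (d.-tuple R) :=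
  [set th | forall j : 'I_d, Tset b (tnth th j)].

Definition mixpmf (b : nat -> R) (d : nat) (Q : probability (d.-tuple R) R)
  (k : d.-tuple nat) : R :=
  fine (\int[Q]_(th in Theta b d) (\prod_(j < d) fpsd b (tnth th j) (tnth k j))%:E).

Definition lik (b : nat -> R) (d n : nat) (Q : probability (d.-tuple R) R)
  (x : n.-tuple (d.-tuple nat)) : R :=
  \prod_(i < n) mixpmf b d Q (tnth x i).

Definition is_npmle (b : nat -> R) (d n : nat) (x : n.-tuple (d.-tuple nat))
  (Q : probability (d.-tuple R) R) : Prop :=
  Q (Theta b d) = 1%E /\
  forall Q' : probability (d.-tuple R) R, Q' (Theta b d) = 1%E ->
    lik b d n Q' x <= lik b d n Q x.

Definition hellinger (d : nat) (p1 p2 : d.-tuple nat -> R) : R :=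
  Num.sqrt (fine ((2^-1)%:E *
    esum [set: d.-tuple nat] (fun k => ((Num.sqrt (p1 k) - Num.sqrt (p2 k)) ^+ 2)%:E)))%E.

Definition Psample (d n : nat) (p : d.-tuple nat -> R) (E : set (n.-tuple (d.-tuple nat)))
  : \bar R :=
  esum E (fun x => (\prod_(i < n) p (tnth x i))%:E).

Definition supp (d : nat) (Q : probability (d.-tuple R) R) : set (d.-tuple R) :=
  [set th : d.-tuple R | forall e : R, 0 < e ->
     (0 < Q [set th' : d.-tuple R | forall j : 'I_d, (`|tnth th' j - tnth th j| < e)%R])%E].

Definition zero_tuple (d : nat) : d.-tuple R := [tuple of nseq d 0].

Definition A1 (b : nat -> R) (d : nat) (Q0 : probability (d.-tuple R) R) (q0 M : R) : Prop :=
  match conv_radius b with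
  | EFin r => 0 < q0 < 1 /\
      supp d Q0 `<=` [set th | forall j : 'I_d, 0 <= tnth th j <= q0 * r]
  | +oo%E => 0 < M /\
      supp d Q0 `<=` [set th | forall j : 'I_d, 0 <= tnth th j <= M]
  | -oo%E => False
  end.

Definition A2 (b : nat -> R) (d : nat) (Q0 : probability (d.-tuple R) R) (delta0 eta0 : R)
  : Prop :=
  [/\ 0 < delta0, (delta0%:E < conv_radius b)%E,
      supp d Q0 `&` [set th | exists j : 'I_d, 0 < tnth th j < delta0] = set0,
      0 < eta0 <= 1 &
      ((0 < Q0 [set zero_tuple d])%E -> eta0 < 1 /\ (Q0 [set zero_tuple d] <= (1 - eta0)%:E)%E)].

Definition A3 (b : nat -> R) (V : nat) : Prop :=
  forall k : nat, (V <= k)%N -> b k / b 0%N >= k%:R ^- k.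

Definition A4 (b : nat -> R) : Prop :=
  exists l : R, (fun k => b k.+1 / b k) @ \oo --> l.

Definition t0c (b : nat -> R) (q0 : R) : R :=
  match conv_radius b with EFin _ => (q0 + 1) / 2 | _ => 2^-1 end.
Definition thtc (b : nat -> R) (q0 M : R) : R :=
  match conv_radius b with EFin r => q0 * r | _ => M end.

Definition Uc (b : nat -> R) (tht : R) : int :=
  Num.floor (tht * sup [set derive1 (bfun b) th / bfun b th | th in `]0, tht[%classic]) + 1.

Definition Wc (b : nat -> R) (t0 tht : R) : nat :=
  let P := fun w : nat =>
    (3 <= w)%N /\ sup [set b k.+1 / b k | k in [set k : nat | (w <= k)%N]] <= t0 / tht in
  xget 0%N [set w | P w /\ forall w', P w' -> (w <= w')%N].

Definition Nc (b : nat -> R) (d V : nat) (t0 tht delta0 eta0 : R) : int :=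
  let W := Wc b t0 tht in
  Num.floor (Num.max
    ((d%:R)^-1 * expR (ln (1 / Num.sqrt t0) *
       Num.max (Num.max (Num.max (Num.max ((Uc b tht)%:~R) V%:R) W%:R)
                 (bfun b delta0 / (b 0%N * eta0 `^ (d%:R)^-1)))
               (1 / delta0 `^ (d%:R)^-1)))
    (1 / (t0 ^+ (W - 1) * (1 - t0)))) + 1.

End PSD.

Definition RR : realType := Rdefinitions.R.

(* Main.v *)
Require Import Defs.
From HB Require Import structures.
From mathcomp Require Import all_boot all_order all_algebra.
From mathcomp Require Import all_classical all_reals all_analysis.
From mathcomp Require Import Rstruct Rstruct_topology.
From mathcomp Require Import measurable_realfun.
From mathcomp Require Import ring lra.
(* Since the mixtures form a convex set, comparing the NPMLE r with its midpoint
   with the truth p gives the basic inequality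
     sum_i (r - p)/(r + p)(X_i) >= 0,
   whence, with H^2 = 1/2 sum_k (r - p)^2/(r + p) >= h^2(r, p),
     H^2 <= sum_k (r - p)/(r + p)(k) (P_n - p)(k).
   On a box S = {0, ..., K-1}^d the right-hand side is split by AM-GM into H^2/2
   plus the chi-square statistic Z^2 = sum_S (P_n - p)^2/p, whose mean is at most
   K^d/n; off S it is at most T = P_n(S^c) + p(S^c). Hence h^2 <= 2 Z^2 + 2 T, and no
   empirical process theory is needed. The ratios b_{k+1}/b_k make the tails of
   the power series distributions geometric beyond W, so that p(S^c) <= 2/n for
   K of order 2 log(nd)/log(1/t0), and Markov's inequality gives the claim
   (even without the logarithmic factor log(nd) and the first term). *)

Set Implicit Arguments.
Unset Strict Implicit.

Import Order.TTheory GRing.Theory Num.Theory.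
Import numFieldNormedType.Exports.
Local Open Scope classical_set_scope.
Local Open Scope ring_scope.

Section FiniteProduct.
Context {R : realType} {Y : finType}.
Variables (p : Y -> R) (n : nat).
Hypothesis p1 : \sum_y p y = 1.

Local Notation wt := (fun y : {ffun 'I_n -> Y} => \prod_(i < n) p (y i)).

Lemma sum_wt_prod (h : 'I_n -> Y -> R) :
  \sum_(y : {ffun 'I_n -> Y}) wt y * \prod_(i < n) h i (y i) =
  \prod_(i < n) \sum_y p y * h i y.
Proof.
rewrite bigA_distr_bigA /=; apply: eq_bigr => y _.
by rewrite -big_split.
Qed.

Lemma sum_wt_coord (f : Y -> R) (i : 'I_n) :
  \sum_(y : {ffun 'I_n -> Y}) wt y * f (y i) = \sum_y p y * f y.
Proof.
have := sum_wt_prod (fun l a => if l == i then f a else 1).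
rewrite (bigD1 i) //= eqxx [X in _ = _ * X -> _]big1 ?mulr1; last first.
  by move=> l /negPf li; rewrite li; under eq_bigr do rewrite mulr1.
move=> <-; apply: eq_bigr => y _; congr (_ * _).
by rewrite (bigD1 i) //= eqxx big1 ?mulr1 // => l /negPf ->.
Qed.

Lemma sum_wt_coord2 (f : Y -> R) (i j : 'I_n) : i != j ->
  \sum_y p y * f y = 0 ->
  \sum_(y : {ffun 'I_n -> Y}) wt y * (f (y i) * f (y j)) = 0.
Proof.
move=> ij f0.
have := sum_wt_prod (fun l a => (if l == i then f a else 1) *
                                (if l == j then f a else 1)).
rewrite [X in _ = X -> _](bigD1 i) //= eqxx (negPf ij).
rewrite [X in _ = X * _ -> _](eq_bigr (fun a => p a * f a)); last by move=> a _; rewrite mulr1.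
rewrite f0 mul0r => E0; rewrite -[RHS]E0; apply: eq_bigr => y _; congr (_ * _).
rewrite (bigD1 i) //= eqxx (negPf ij) mulr1; congr (_ * _).
rewrite (bigD1 j) /=; last by rewrite eq_sym.
rewrite eqxx [j == i]eq_sym (negPf ij) mul1r big1 ?mulr1 //.
by move=> l /andP[/negPf -> /negPf ->]; rewrite mulr1.
Qed.

Lemma sum_wt_sqr (f : Y -> R) : \sum_y p y * f y = 0 ->
  \sum_(y : {ffun 'I_n -> Y}) wt y * (\sum_(i < n) f (y i)) ^+ 2 =
  n%:R * \sum_y p y * f y ^+ 2.
Proof.
move=> f0.
transitivity (\sum_(y : {ffun 'I_n -> Y}) \sum_(i < n) \sum_(j < n)
    wt y * (f (y i) * f (y j))).
  apply: eq_bigr => y _; rewrite expr2 big_distrlr /= mulr_sumr.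
  by apply: eq_bigr => i _; rewrite mulr_sumr.
rewrite exchange_big /= -[n in RHS]card_ord -sum1_card natr_sum mulr_suml.
apply: eq_bigr => i _; rewrite exchange_big /= (bigD1 i) //= [X in _ + X]big1 ?addr0.
  by rewrite mul1r (sum_wt_coord (fun a => f a * f a)).
by move=> j ji; rewrite sum_wt_coord2 // eq_sym.
Qed.

Lemma sum_wt : \sum_(y : {ffun 'I_n -> Y}) wt y = 1.
Proof. by rewrite -(bigA_distr_bigA (fun _ => p)) /= big1. Qed.

End FiniteProduct.

Definition emp {R : realType} {X : eqType} {n : nat} (x : n.-tuple X) (k : X) : R :=
  (\sum_(i < n) (tnth x i == k)%:R) / n%:R.

(* [2 Z^2 + 2 T], with [Z^2] a chi-square statistic on the cells of [S] and
   [T = P_n(S^c) + p(S^c)]. Cells with [p k = 0] contribute [0] to [Z^2], by the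
   convention [u / 0 = 0]; almost surely they are never observed. *)
Definition deviation {R : realType} {X : eqType} {n : nat} (p : X -> R)
    (S : seq X) (x : n.-tuple X) : R :=
  2 * \sum_(k <- S) (emp x k - p k) ^+ 2 / p k +
  2 * ((1 - \sum_(k <- S) emp x k) + (1 - \sum_(k <- S) p k)).

Section Empirical.
Context {R : realType} {X : eqType} {n : nat}.
Implicit Types (x : n.-tuple X) (S : seq X).

Lemma emp_ge0 x k : 0 <= emp x k :> R.
Proof. by rewrite divr_ge0 // sumr_ge0. Qed.

Lemma sum_emp (h : X -> R) S x : uniq S ->
  \sum_(k <- S) h k * emp x k =
  (\sum_(i < n | tnth x i \in S) h (tnth x i)) / n%:R.
Proof.
move=> uS; rewrite mulr_suml.
under eq_bigr do rewrite /emp mulrA mulr_sumr mulr_suml.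
rewrite exchange_big [RHS]big_mkcond /=; apply: eq_bigr => i _.
rewrite -mulr_suml; case: ifPn => xS.
  rewrite (bigD1_seq (tnth x i)) //= eqxx mulr1 big1 ?addr0 // => k /negPf.
  by rewrite eq_sym => ->; rewrite mulr0.
rewrite big1_seq ?mul0r // => k /andP[_ kS].
by have [kx|] := eqVneq; rewrite ?mulr0 //; rewrite kx kS in xS.
Qed.

Lemma sum_emp_le1 S x : uniq S -> \sum_(k <- S) emp x k <= 1 :> R.
Proof.
move=> uS; have := sum_emp (fun=> 1) x uS.
under eq_bigr do rewrite mul1r.
move=> ->; have [->|n0] := eqVneq (n%:R : R) 0; first by rewrite invr0 mulr0.
rewrite ler_pdivrMr ?lt0r ?n0 ?ler0n // mul1r.
rewrite -[n in leRHS]card_ord -sum1_card natr_sum [leLHS]big_mkcond.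
by apply: ler_sum => i _; case: ifP.
Qed.

End Empirical.

Section Markov.
Context {R : realType} {X : choiceType}.
Variables (p : X -> R) (n : nat) (S : seq X).
Hypothesis n0 : (0 < n)%N.
Hypothesis p0 : forall k, 0 <= p k.
Hypothesis p1 : forall A : seq X, uniq A -> \sum_(k <- A) p k <= 1.
Hypothesis uS : uniq S.

Lemma deviation_ge0 (x : n.-tuple X) : 0 <= deviation p S x.
Proof.
apply: addr_ge0; apply: mulr_ge0 => //.
  by apply: sumr_ge0 => k _; rewrite divr_ge0 ?sqr_ge0.
by rewrite addr_ge0 // subr_ge0 ?p1 ?sum_emp_le1.
Qed.

Section Finite.
Context {Y : finType}.
Variables (q : Y -> R) (o : X -> Y).
Hypothesis q1 : \sum_y q y = 1.
Hypothesis qo : forall k, k \in S -> q (o k) = p k.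

Lemma sum_wt_deviation :
  \sum_(y : {ffun 'I_n -> Y}) (\prod_(i < n) q (y i)) *
     deviation (q \o id) (map o S) [tuple y i | i < n] <=
  2 * (size S)%:R / n%:R + 4 * (1 - \sum_(k <- S) p k).
Proof.
have nn : n%:R != 0 :> R by rewrite pnatr_eq0 -lt0n.
have qS : \sum_(k <- S) q (o k) = \sum_(k <- S) p k.
  by apply: eq_big_seq => k; exact: qo.
have empE y k : emp [tuple y i | i < n] k = (\sum_(i < n) (y i == k)%:R) / n%:R :> R.
  by rewrite /emp; congr (_ / _); apply: eq_bigr => i _; rewrite tnth_mktuple.
have Eemp k : \sum_(y : {ffun 'I_n -> Y}) (\prod_(i < n) q (y i)) *
     emp [tuple y i | i < n] k = q k.
  transitivity ((\sum_(i < n) \sum_(y : {ffun 'I_n -> Y})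
      (\prod_(l < n) q (y l)) * (y i == k)%:R) / n%:R).
    rewrite exchange_big /= mulr_suml; apply: eq_bigr => y _.
    by rewrite empE mulrA mulr_sumr.
  rewrite (eq_bigr (fun=> q k)) => [|i _].
    by rewrite sumr_const card_ord -[q k *+ n]mulr_natr mulfK.
  rewrite (sum_wt_coord q1 (fun a => (a == k)%:R)).
  rewrite (bigD1 k) //= eqxx mulr1 big1 ?addr0 // => a /negPf ->.
  by rewrite mulr0.
have Esq k : k \in S -> \sum_(y : {ffun 'I_n -> Y}) (\prod_(i < n) q (y i)) *
     ((emp [tuple y i | i < n] (o k) - q (o k)) ^+ 2 / q (o k)) <= n%:R^-1.
  move=> kS; set c := o k.
  have c0 : 0 <= q c by rewrite qo.
  pose f a : R := (a == c)%:R - q c.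
  have sumf (h : R -> R -> R) : \sum_a q a * h (a == c)%:R (q c) =
      q c * h 1 (q c) + (1 - q c) * h 0 (q c).
    rewrite (bigD1 c) //= eqxx; congr (_ + _).
    rewrite -q1 [in RHS](bigD1 c) //= addrAC subrr add0r mulr_suml.
    by apply: eq_bigr => a /negPf ->.
  have f0 : \sum_a q a * f a = 0.
    by rewrite (sumf (fun u v => u - v)); ring.
  have f2 : \sum_a q a * f a ^+ 2 = q c * (1 - q c).
    by rewrite (sumf (fun u v => (u - v) ^+ 2)); ring.
  have ->: \sum_(y : {ffun 'I_n -> Y}) (\prod_(i < n) q (y i)) *
     ((emp [tuple y i | i < n] c - q c) ^+ 2 / q c) =
     (\sum_(y : {ffun 'I_n -> Y}) (\prod_(i < n) q (y i)) *
       (\sum_(i < n) f (y i)) ^+ 2) / n%:R ^+ 2 / q c.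
    rewrite 2!mulr_suml; apply: eq_bigr => y _.
    rewrite empE /f sumrB sumr_const card_ord -[q c *+ n]mulr_natr.
    set s := \sum_i _; set w := \prod_i _.
    rewrite (_ : s / n%:R - q c = (s - q c * n%:R) / n%:R); last by rewrite mulrBl mulfK.
    by rewrite expr_div_n; ring.
  rewrite sum_wt_sqr // f2.
  have [->|cn0] := eqVneq (q c) 0; first by rewrite !(mul0r, mulr0) invr_ge0.
  rewrite [X in X <= _](_ : _ = n%:R^-1 * (1 - q c)); last by field; rewrite nn.
  by rewrite ler_piMr ?invr_ge0 // gerBl.
rewrite /deviation /=.
have lin (I : finType) (w A B : I -> R) (D : R) :
    \sum_i w i * (2 * A i + 2 * ((1 - B i) + D)) =
    2 * (\sum_i w i * A i) + 2 * ((\sum_i w i - \sum_i w i * B i) + (\sum_i w i) * D).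
  rewrite mulr_sumr mulr_suml -sumrB -big_split /= mulr_sumr -big_split /=.
  by apply: eq_bigr => i _; ring.
rewrite {}lin (sum_wt _ q1) mul1r big_map qS.
rewrite [X in 2 * X](_ : _ = \sum_(k <- S) \sum_(y : {ffun 'I_n -> Y})
    (\prod_(i < n) q (y i)) *
     ((emp [tuple y i | i < n] (o k) - q (o k)) ^+ 2 / q (o k))); last first.
  rewrite exchange_big /=; apply: eq_bigr => y _.
  by rewrite big_map mulr_sumr.
rewrite [X in 1 - X](_ : _ = \sum_(k <- S) p k); last first.
  rewrite -qS -(big_map o xpredT q).
  transitivity (\sum_(k <- map o S) \sum_(y : {ffun 'I_n -> Y})
      (\prod_(i < n) q (y i)) * emp [tuple y i | i < n] k).
    by rewrite exchange_big /=; apply: eq_bigr => y _; rewrite mulr_sumr.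
  by apply: eq_bigr => k _; exact: Eemp.
have: \sum_(k <- S) \sum_(y : {ffun 'I_n -> Y}) (\prod_(i < n) q (y i)) *
     ((emp [tuple y i | i < n] (o k) - q (o k)) ^+ 2 / q (o k)) <=
   (size S)%:R / n%:R.
  rewrite [leRHS](_ : _ = \sum_(k <- S) n%:R^-1); last first.
    by rewrite big_const_seq count_predT iter_addr_0 mulr_natl.
  rewrite big_seq [leRHS]big_seq.
  by apply: ler_sum => k kS; exact: Esq.
by rewrite -[2 * _ / _]mulrA; lra.
Qed.
End Finite.
End Markov.
Section MarkovInequality.
Context {R : realType} {X : choiceType}.
Variables (p : X -> R) (n : nat) (S : seq X).
Hypothesis n0 : (0 < n)%N.
Hypothesis p0 : forall k, 0 <= p k.
Hypothesis p1 : forall A : seq X, uniq A -> \sum_(k <- A) p k <= 1.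
Hypothesis uS : uniq S.

Lemma deviation_map {Y : eqType} (q : Y -> R) (o : X -> Y) (x : n.-tuple X) :
  (forall k, k \in S -> q (o k) = p k) ->
  (forall i k, k \in S -> (o (tnth x i) == o k) = (tnth x i == k)) ->
  deviation q (map o S) [tuple o (tnth x i) | i < n] = deviation p S x.
Proof.
move=> qo oinj.
have empE k : k \in S -> emp [tuple o (tnth x i) | i < n] (o k) = emp x k :> R.
  by move=> kS; congr (_ / _); apply: eq_bigr => i _; rewrite tnth_mktuple oinj.
rewrite /deviation !big_map; congr (2 * _ + 2 * ((_ - _) + (_ - _))).
- by apply: eq_big_seq => k kS; rewrite empE // qo.
- by apply: eq_big_seq => k kS; rewrite empE.
- by apply: eq_big_seq => k kS; rewrite qo.
Qed.

Lemma sum_option (Y : finType) (F : option Y -> R) :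
  \sum_o F o = F None + \sum_y F (Some y).
Proof.
rewrite (bigD1 None) //=; congr (_ + _).
rewrite (reindex_omap Some id) //=; last by case.
by apply: eq_bigl => y; rewrite eqxx.
Qed.

Lemma sum_seq_sub (A : seq X) (F : X -> R) : uniq A ->
  \sum_(y : seq_sub A) F (val y) = \sum_(k <- A) F k.
Proof.
move=> uA.
transitivity (\sum_(k <- map val (enum {: seq_sub A})) F k).
  by rewrite big_map big_enum.
apply: perm_big; apply: uniq_perm => //.
  by rewrite map_inj_uniq ?enum_uniq //; exact: val_inj.
move=> k; apply/mapP/idP => [[y _ ->]|kA]; first exact: valP.
by exists (SeqSub kA); rewrite ?mem_enum.
Qed.

Lemma sum_uniq_le (Y : finType) (t : seq Y) (F : Y -> R) :
  (forall y, 0 <= F y) -> uniq t -> \sum_(y <- t) F y <= \sum_y F y.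
Proof.
move=> F0 ut; rewrite big_uniq //= big_mkcond /=.
by apply: ler_sum => y _; case: ifP.
Qed.

(* Everything outside the finitely many observed values is merged into one
   cemetery point [None], so that the remaining computation is finite. *)
Lemma deviation_markov (E : set (n.-tuple X)) (c : R) : 0 < c ->
  (forall x, E x -> (forall i, 0 < p (tnth x i)) -> c <= deviation p S x) ->
  (esum E (fun x => (\prod_(i < n) p (tnth x i))%:E) <=
   ((2 * (size S)%:R / n%:R + 4 * (1 - \sum_(k <- S) p k)) / c)%:E)%E.
Proof.
move=> c0 Ec; apply: ge_ereal_sup => _ [F [finF FE] <-].
rewrite fsbig_finite // sumEFin lee_fin; set s := finmap.enum_fset _.
pose A := undup (S ++ flatten (map val s)).
have uA : uniq A by exact: undup_uniq.
have SA k : k \in S -> k \in A by rewrite mem_undup mem_cat => ->.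
have xA x i : x \in s -> tnth x i \in A.
  move=> xs; rewrite mem_undup mem_cat; apply/orP; right.
  by apply/flattenP; exists (val x); [exact: map_f|exact: mem_tnth].
pose o (k : X) : option (seq_sub A) := insub k.
have oE k (kA : k \in A) : o k = Some (SeqSub kA) by rewrite /o insubT.
pose q (a : option (seq_sub A)) := if a is Some k then p (val k) else 1 - \sum_(k <- A) p k.
have qo k : k \in A -> q (o k) = p k by move=> kA; rewrite (oE _ kA).
have q1 : \sum_a q a = 1 by rewrite sum_option /= sum_seq_sub // subrK.
have q0 a : 0 <= q a by case: a => [a|] /=; rewrite ?subr_ge0 ?p1.
pose y (x : n.-tuple X) : {ffun 'I_n -> option (seq_sub A)} := [ffun i => o (tnth x i)].
have yP x : x \in s -> (\prod_(i < n) q (y x i)) = \prod_(i < n) p (tnth x i).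
  by move=> xs; apply: eq_bigr => i _; rewrite ffunE qo // xA.
have yD x : x \in s -> deviation q (map o S) [tuple y x i | i < n] = deviation p S x.
  move=> xs; rewrite -(@deviation_map _ q o) => [|k /SA|i k kS]; last 2 first.
  - exact: qo.
  - apply/eqP/eqP => [|->//]; rewrite (oE _ (xA _ i xs)) (oE _ (SA _ kS)).
    by case.
  by congr deviation; apply: eq_from_tnth => i; rewrite !tnth_mktuple ffunE.
have yinj : {in s &, injective y}.
  move=> x x' xs xs' /ffunP xx'; apply: eq_from_tnth => i.
  by have := xx' i; rewrite !ffunE (oE _ (xA _ i xs)) (oE _ (xA _ i xs')) => -[].
rewrite ler_pdivlMr //.
apply: le_trans (@sum_wt_deviation _ _ p n S n0 p0 _ q o q1 _); last by move=> k /SA; exact: qo.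
pose G := fun y : {ffun 'I_n -> option (seq_sub A)} => (\prod_(i < n) q (y i)) *
     deviation q (map o S) [tuple y i | i < n].
have G0 z : 0 <= G z.
  apply: mulr_ge0; first by apply: prodr_ge0.
  refine (@deviation_ge0 R _ q n (map o S) q0 _ _ _) => [A1 uA1|].
    by rewrite -q1; exact: sum_uniq_le.
  rewrite map_inj_in_uniq // => k l /SA kA /SA lA.
  by rewrite (oE _ kA) (oE _ lA) => -[].
apply: (@le_trans _ _ (\sum_(z <- map y s) G z)); last first.
  apply: sum_uniq_le => //; rewrite map_inj_in_uniq //.
  exact: finmap.fset_uniq.
rewrite big_map mulr_suml big_seq [leRHS]big_seq; apply: ler_sum => x xs.
rewrite /G yP // yD //.
have [/forallP px|/forallPn[i]] := boolP [forall i, 0 < p (tnth x i)].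
  apply: ler_wpM2l; first by apply: prodr_ge0.
  apply: Ec => //; apply: FE; move: xs.
  by rewrite in_fset_set // inE.
rewrite lt0r p0 andbT negbK => /eqP px.
by rewrite (bigD1 i) //= px !mul0r.
Qed.
End MarkovInequality.
Section DeterministicBound.
Context {R : realType} {X : eqType}.
Variables (p r : X -> R) (S : seq X) (n : nat) (x : n.-tuple X).
Hypothesis n0 : (0 < n)%N.
Hypothesis p0 : forall k, 0 <= p k.
Hypothesis r0 : forall k, 0 <= r k.
Hypothesis p1 : forall A : seq X, uniq A -> \sum_(k <- A) p k <= 1.
Hypothesis r1 : forall A : seq X, uniq A -> \sum_(k <- A) r k <= 1.
Hypothesis uS : uniq S.
Hypothesis px : forall i, 0 < p (tnth x i).

Local Notation g := (fun k => (r k - p k) / (r k + p k)).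

Hypothesis score_ge0 : 0 <= \sum_(i < n) g (tnth x i).

Lemma sqr_sqrtB_le (u v : R) : 0 <= u -> 0 <= v ->
  (Num.sqrt u - Num.sqrt v) ^+ 2 <= (u - v) ^+ 2 / (u + v).
Proof.
move=> u0 v0; have [uv|uv] := eqVneq (u + v) 0.
  have [-> ->] : u = 0 /\ v = 0 by split; lra.
  by rewrite !subrr expr0n mul0r.
have uvp : 0 < u + v by rewrite lt0r uv addr_ge0.
rewrite ler_pdivlMr //.
have := sqr_sqrtr u0; have := sqr_sqrtr v0.
have := sqrtr_ge0 u; have := sqrtr_ge0 v.
move: (Num.sqrt u) (Num.sqrt v) => a b b0 a0 <- <-.
rewrite subr_sqr exprMn ler_wpM2l ?sqr_ge0 //.
have : 0 <= a * b by exact: mulr_ge0.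
by nra.
Qed.

Lemma score_emp_le k :
  g k * (emp x k - p k) <=
  4^-1 * ((r k - p k) ^+ 2 / (r k + p k)) + (emp x k - p k) ^+ 2 / p k.
Proof.
have [pk|pk] := eqVneq (p k) 0.
  have -> : emp x k = 0 :> R.
    rewrite /emp big1 ?mul0r // => i _; case: eqVneq => // xk.
    by have := px i; rewrite xk pk ltxx.
  by rewrite pk subrr !mulr0 addr_ge0 // ?invr0 ?mulr0 // mulr_ge0 //
    divr_ge0 ?sqr_ge0 ?addr_ge0.
have pk0 : 0 < p k by rewrite lt0r pk p0.
have rpk : 0 < r k + p k by rewrite ltr_wpDl.
set w := (r k - p k) / (r k + p k); set v := emp x k - p k.
have -> : (r k - p k) ^+ 2 / (r k + p k) = w ^+ 2 * (r k + p k).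
  by rewrite /w; field; rewrite gt_eqF.
apply: (@le_trans _ _ (4^-1 * (w ^+ 2 * p k) + v ^+ 2 / p k)); last first.
  rewrite lerD2r ler_pM2l ?invr_gt0 // ler_wpM2l ?sqr_ge0 //.
  by rewrite lerDr r0.
rewrite -subr_ge0 (_ : _ - _ = (w / 2 * p k - v) ^+ 2 / p k).
  by rewrite divr_ge0 ?sqr_ge0.
by field; rewrite gt_eqF.
Qed.

Lemma score_emp_le_add k : g k * (emp x k - p k) <= emp x k + p k.
Proof.
have g1 : `|g k| <= 1.
  have [->|rpk] := eqVneq (r k + p k) 0; first by rewrite invr0 mulr0 normr0.
  have rp : 0 < r k + p k by rewrite lt0r rpk addr_ge0.
  rewrite normrM normfV (gtr0_norm rp) ler_pdivrMr // mul1r.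
  by rewrite ler_norml; have := p0 k; have := r0 k; lra.
apply: le_trans (ler_norm _) _; rewrite normrM.
apply: le_trans (ler_wpM2r (normr_ge0 _) g1) _; rewrite mul1r.
apply: le_trans (ler_normB _ _) _.
by rewrite !ger0_norm ?emp_ge0.
Qed.

Lemma score_mulE k :
  2^-1 * ((r k - p k) ^+ 2 / (r k + p k)) = 2^-1 * (r k - p k) - g k * p k.
Proof.
have [rp|rp] := eqVneq (r k + p k) 0; last by field.
have -> : r k = 0 by have := p0 k; have := r0 k; lra.
have -> : p k = 0 by have := p0 k; have := r0 k; lra.
by rewrite subrr !(mulr0, mul0r, expr0n) subrr.
Qed.

Lemma hellinger_le_deviation (G : seq X) : uniq G ->
  2^-1 * \sum_(k <- G) (Num.sqrt (r k) - Num.sqrt (p k)) ^+ 2 <= deviation p S x.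
Proof.
move=> uG; pose A := undup (G ++ S ++ x).
have uA : uniq A by exact: undup_uniq.
have subA (B : seq X) (F : X -> R) : uniq B -> {subset B <= A} ->
    \sum_(k <- B) F k = \sum_(k <- A) (k \in B)%:R * F k.
  move=> uB BA; rewrite [RHS](eq_bigr (fun k => if k \in B then F k else 0)); last first.
    by move=> k _; case: (k \in B); rewrite ?mul1r ?mul0r.
  rewrite -big_mkcond -[RHS]big_filter; apply: perm_big.
  apply: uniq_perm => //; first exact: filter_uniq.
  by move=> k; rewrite mem_filter; case: (boolP (k \in B)) => // /BA ->.
have GA : {subset G <= A} by move=> k kG; rewrite mem_undup mem_cat kG.
have SA : {subset S <= A} by move=> k kS; rewrite mem_undup !mem_cat kS orbT.
have xA i : tnth x i \in A by rewrite mem_undup !mem_cat mem_tnth !orbT.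
pose D k := (r k - p k) ^+ 2 / (r k + p k).
have D0 k : 0 <= D k by rewrite divr_ge0 ?sqr_ge0 ?addr_ge0.
have sumA (h : X -> R) : \sum_(k <- A) h k * emp x k = (\sum_(i < n) h (tnth x i)) / n%:R.
  rewrite sum_emp //; congr (_ / _).
  by apply: eq_bigl => i; rewrite xA.
have empA : \sum_(k <- A) emp x k = 1 :> R.
  rewrite (eq_bigr (fun k => 1 * emp x k)) => [|k _]; last by rewrite mul1r.
  rewrite (sumA (fun=> 1)).
  by rewrite sumr_const card_ord divff // pnatr_eq0 -lt0n.
have gA : 0 <= \sum_(k <- A) g k * emp x k by rewrite sumA divr_ge0.
set H := \sum_(k <- A) D k.
have HG : \sum_(k <- G) (Num.sqrt (r k) - Num.sqrt (p k)) ^+ 2 <= H.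
  apply: (@le_trans _ _ (\sum_(k <- G) D k)).
    by apply: ler_sum => k _; exact: sqr_sqrtB_le.
  rewrite subA //; apply: ler_sum => k _.
  by case: (k \in G); rewrite ?mul1r ?mul0r.
have HE : 2^-1 * H = 2^-1 * (\sum_(k <- A) r k - \sum_(k <- A) p k) -
    \sum_(k <- A) g k * p k.
  rewrite -sumrB !mulr_sumr -sumrB; apply: eq_bigr => k _; exact: score_mulE.
have gB : \sum_(k <- A) g k * emp x k - \sum_(k <- A) g k * p k <=
   4^-1 * H + \sum_(k <- S) (emp x k - p k) ^+ 2 / p k +
   ((1 + \sum_(k <- A) p k) - (\sum_(k <- S) emp x k + \sum_(k <- S) p k)).
  rewrite -sumrB (subA S (fun k => (emp x k - p k) ^+ 2 / p k)) //.
  rewrite (subA S (emp x)) // (subA S p) // mulr_sumr.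
  rewrite -[X in X + \sum_(k <- A) p k]empA -!big_split /= -sumrB -big_split /=; apply: ler_sum => k _.
  rewrite -mulrBr; case: (k \in S); rewrite ?mul1r ?mul0r ?subrr ?addr0 ?subr0.
    exact: score_emp_le.
  by rewrite ler_wpDl ?score_emp_le_add // mulr_ge0.
have := p1 uA; have := r1 uA; rewrite /deviation; lra.
Qed.

End DeterministicBound.
Section PowerSeries.
Context {R : realType}.
Variable b : nat -> R.
Hypothesis b0 : forall k, 0 < b k.

Lemma Tset_ge0 th : Tset b th -> 0 <= th. Proof. by case. Qed.

Lemma coef_ge0 th k : Tset b th -> 0 <= b k * th ^+ k.
Proof. by move=> /Tset_ge0 th0; rewrite mulr_ge0 ?exprn_ge0 // ltW. Qed.

Lemma partial_sum_le_bfun th M : Tset b th ->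
  \sum_(k < M) b k * th ^+ k <= bfun b th.
Proof.
move=> T; have := @nondecreasing_cvgn_le R (series (fun k => b k * th ^+ k)) _ (proj2 T) M.
rewrite /bfun /series /= big_mkord; apply.
by apply: nondecreasing_series => k _ _; exact: coef_ge0.
Qed.

Lemma bfun_gt0 th : Tset b th -> 0 < bfun b th.
Proof.
move=> T; apply: lt_le_trans (b0 0%N) _.
by have := partial_sum_le_bfun 1 T; rewrite big_ord1 expr0 mulr1.
Qed.

Lemma bfun_le th c : Tset b th ->
  (forall M, \sum_(k < M) b k * th ^+ k <= c) -> bfun b th <= c.
Proof.
move=> T H; apply: limr_le; first exact: (proj2 T).
by apply: nearW => M; rewrite /series /= big_mkord.
Qed.

Lemma fpsd_ge0 th k : Tset b th -> 0 <= fpsd b th k.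
Proof. by move=> T; rewrite divr_ge0 ?coef_ge0 // ltW // bfun_gt0. Qed.

Lemma sum_fpsd_le1 th M : Tset b th -> \sum_(k < M) fpsd b th k <= 1.
Proof.
move=> T; rewrite -mulr_suml ler_pdivrMr ?bfun_gt0 // mul1r.
exact: partial_sum_le_bfun.
Qed.

Lemma Tset_down s th : 0 <= s -> s <= th -> Tset b th -> Tset b s.
Proof.
move=> s0 sth T; split=> //; apply: (series_le_cvg _ _ _ (proj2 T)) => k.
- by rewrite mulr_ge0 ?exprn_ge0 // ltW.
- exact: coef_ge0.
- by rewrite ler_pM2l // lerXn2r // nnegrE // (le_trans s0).
Qed.

Lemma measurable_Tset : measurable (Tset b).
Proof.
apply: is_interval_measurable => s t Ts Tt u /andP[su ut].
by apply: Tset_down ut Tt; rewrite (le_trans (Tset_ge0 Ts)).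
Qed.

Lemma measurable_fpsd k : measurable_fun (Tset b) (fpsd b ^~ k).
Proof.
have mb : measurable_fun (Tset b) (bfun b).
  refine (@measurable_fun_cvg _ _ R (Tset b) (fun M th => series (fun k => b k * th ^+ k) M) (bfun b) _ _).
    move=> M; rewrite /series /=; apply: measurable_sum => i.
    by apply: measurable_funM => //; apply: measurable_funX.
  by move=> th T; exact: (proj2 T).
refine (@eq_measurable_fun _ _ R R _ (fun th : R => (b k * th ^+ k) * (bfun b th `^ (-1))) _ _ _).
  move=> th /set_mem T; rewrite powR_inv1 //.
  by rewrite ltW // bfun_gt0.
apply: measurable_funM; last exact: measurableT_comp (measurable_powR _) mb.
by apply: measurable_funM => //; apply: measurable_funX.
Qed.

Lemma fpsd_tail (W K : nat) (t0 tht th : R) : 0 < t0 < 1 ->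
  (forall k, (W <= k)%N -> b k.+1 * tht <= t0 * b k) -> (W <= K)%N ->
  Tset b th -> th <= tht ->
  1 - \sum_(k < K) fpsd b th k <= t0 ^+ (K - W) / (1 - t0).
Proof.
move=> /andP[t00 t01] ratio WK T thle.
have th0 := Tset_ge0 T.
have geo j : b (W + j)%N * th ^+ (W + j) <= t0 ^+ j * bfun b th.
  elim: j => [|j IH].
    rewrite addn0 expr0 mul1r; apply: le_trans (partial_sum_le_bfun W.+1 T).
    by rewrite big_ord_recr /= lerDr sumr_ge0 // => i _; exact: coef_ge0.
  apply: (@le_trans _ _ (t0 * (b (W + j)%N * th ^+ (W + j)))); last first.
    by rewrite [t0 ^+ j.+1]exprS -mulrA ler_pM2l.
  rewrite addnS [th ^+ _.+1]exprS !mulrA ler_wpM2r ?exprn_ge0 //.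
  apply: le_trans (ratio _ (leq_addr _ _)).
  by rewrite ler_pM2l.
have bth := bfun_gt0 T.
rewrite -(ler_pM2r bth) mulrBl mul1r mulr_suml.
rewrite (eq_bigr (fun k : 'I_K => b k * th ^+ k)); last first.
  by move=> k _; rewrite /fpsd divfK // gt_eqF.
rewrite lerBlDl; apply: bfun_le => // M.
apply: (@le_trans _ _ (\sum_(k < K + M) b k * th ^+ k)).
  rewrite addnC big_split_ord /= lerDl; apply: sumr_ge0 => i _; exact: coef_ge0.
rewrite big_split_ord /= lerD2l.
apply: (@le_trans _ _ (\sum_(j < M) t0 ^+ (K - W) * bfun b th * t0 ^+ j)).
  apply: ler_sum => j _; have := geo (K - W + j)%N.
  by rewrite addnA subnKC // [t0 ^+ (_ + _)]exprD mulrAC.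
rewrite -mulr_sumr [leLHS]mulrAC ler_wpM2r //; first exact: ltW.
rewrite ler_wpM2l ?exprn_ge0 ?(ltW t00) //.
rewrite -[leRHS]mul1r ler_pdivlMr ?subr_gt0 //.
rewrite (_ : _ * _ = 1 - t0 ^+ M) ?gerBl ?exprn_ge0 ?(ltW t00) //.
by rewrite -[RHS]opprB subrX1; ring.
Qed.

Lemma ratio_limit_le (l th : R) : (fun k => b k.+1 / b k) @ \oo --> l ->
  Tset b th -> l * th <= 1.
Proof.
move=> bl T; rewrite leNgt; apply/negP => lth.
have th0 : 0 < th.
  by rewrite lt0r (Tset_ge0 T) andbT; apply/eqP => th0; move: lth; rewrite th0 mulr0 ltr10.
have tl : th^-1 < l by rewrite -[th^-1]mul1r ltr_pdivrMr.
have [N _ HN] := cvgr_gt _ bl _ tl.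
pose a k := b k * th ^+ k.
have inc j : a N <= a (N + j)%N.
  elim: j => [|j IH]; first by rewrite addn0.
  apply: le_trans IH _; rewrite addnS /a exprS mulrA ler_wpM2r ?exprn_ge0 ?(ltW th0) //.
  have /= := HN (N + j)%N (leq_addr _ _).
  by rewrite ltr_pdivlMr // mulrC ltr_pdivrMr // => /ltW.
have aN : 0 < a N by rewrite /a mulr_gt0 ?exprn_gt0.
have a_cvg := cvg_series_cvg_0 (proj2 T).
have [M _ HM] := cvgr_lt _ a_cvg _ aN.
by have /= := HM (N + M)%N (leq_addl _ _); rewrite ltNge inc.
Qed.

Lemma WcP (t0 tht l : R) : 0 < t0 -> 0 < tht ->
  (fun k => b k.+1 / b k) @ \oo --> l -> l < t0 / tht ->
  (3 <= Wc b t0 tht)%N /\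
  forall k, (Wc b t0 tht <= k)%N -> b k.+1 * tht <= t0 * b k.
Proof.
move=> t00 tht0 bl lt.
pose P w := (3 <= w)%N /\
  sup [set b k.+1 / b k | k in [set k : nat | (w <= k)%N]] <= t0 / tht.
have -> : Wc b t0 tht = xget 0%N [set w | P w /\ forall w', P w' -> (w <= w')%N] by [].
have bnd w : has_ubound [set b k.+1 / b k | k in [set k : nat | (w <= k)%N]].
  have [M [_ HM]] := cvg_seq_bounded (cvgP _ bl).
  exists (M + 1) => _ [k _ <-]; apply: le_trans (ler_norm _) _.
  by apply: HM => //; rewrite ltrDl.
have [N _ HN] := cvgr_lt _ bl _ lt.
have exP : exists w, `[< P w >].
  exists (maxn 3 N); apply/asboolP; split; first exact: leq_maxl.
  apply: ge_sup; first by eexists; exists (maxn 3 N) => /=.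
  move=> _ [k /= Nk <-]; apply/ltW/HN => /=.
  by rewrite (leq_trans _ Nk) // leq_maxr.
have exQ : exists w, P w /\ forall w', P w' -> (w <= w')%N.
  case: (ex_minnP exP) => w /asboolP Pw minw; exists w; split=> // w' Pw'.
  by apply: minw; apply/asboolP.
have [] := xgetPex 0%N exQ; set W := xget _ _ => -[W3 supW] _.
split=> // k Wk.
have : b k.+1 / b k <= t0 / tht.
  by apply: le_trans (ub_le_sup (bnd W) _) supW; exists k.
by rewrite ler_pdivrMr // mulrAC ler_pdivlMr.
Qed.

End PowerSeries.
Lemma sum_subset_le {R : realType} {X : eqType} (A B : seq X) (F : X -> R) :
  (forall k, 0 <= F k) -> uniq A -> uniq B -> {subset A <= B} ->
  \sum_(k <- A) F k <= \sum_(k <- B) F k.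
Proof.
move=> F0 uA uB AB; rewrite [leRHS](bigID (mem A)) /=.
have -> : \sum_(k <- A) F k = \sum_(k <- B | k \in A) F k.
  rewrite -[RHS]big_filter; apply: perm_big; apply: uniq_perm => //.
    exact: filter_uniq.
  by move=> k; rewrite mem_filter; case: (boolP (k \in A)) => // /AB ->.
by rewrite lerDl sumr_ge0.
Qed.

Lemma prod_itv01 {R : realType} (I : Type) (s : seq I) (u : I -> R) :
  (forall i, 0 <= u i <= 1) -> 0 <= \prod_(i <- s) u i <= 1.
Proof.
move=> u01; apply: (big_ind (fun v => 0 <= v <= 1)); rewrite ?ler01 ?lexx //.
by move=> x y /andP[x0 x1] /andP[y0 y1]; rewrite mulr_ge0 ?mulr_ile1.
Qed.

Lemma prod_ge_1Bsum {R : realType} (I : Type) (s : seq I) (u : I -> R) :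
  (forall i, 0 <= u i <= 1) ->
  1 - \sum_(i <- s) (1 - u i) <= \prod_(i <- s) u i.
Proof.
move=> u01; elim: s => [|i s IH]; first by rewrite !big_nil subr0.
rewrite !big_cons; have := prod_itv01 s u01; have := u01 i; nra.
Qed.

Definition box (d M : nat) : seq (d.-tuple nat) :=
  [seq [tuple (f j : nat) | j < d] | f : {ffun 'I_d -> 'I_M}].

Lemma box_inj d M : injective (fun f : {ffun 'I_d -> 'I_M} => [tuple (f j : nat) | j < d]).
Proof.
move=> f g fg; apply/ffunP => j; apply: val_inj.
by have := congr1 (fun t => tnth t j) fg; rewrite !tnth_mktuple.
Qed.

Lemma box_uniq d M : uniq (box d M).
Proof. by rewrite map_inj_uniq ?enum_uniq //; exact: box_inj. Qed.

Lemma size_box d M : size (box d M) = (M ^ d)%N.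
Proof. by rewrite size_map -cardE card_ffun !card_ord. Qed.

Lemma mem_box d M (k : d.-tuple nat) : (forall j, tnth k j < M)%N -> k \in box d M.
Proof.
move=> kM; apply/mapP; exists [ffun j => Ordinal (kM j)]; first by rewrite mem_enum.
by apply: eq_from_tnth => j; rewrite tnth_mktuple ffunE.
Qed.

Lemma sub_box d (A : seq (d.-tuple nat)) : exists M, {subset A <= box d M}.
Proof.
exists (\max_(k <- A) \max_(j < d) tnth k j).+1 => k kA; apply: mem_box => j.
by rewrite ltnS (leq_trans (leq_bigmax j)) // (leq_bigmax_seq k).
Qed.

Section MeasurableTuples.
Context {R : realType} {d : nat}.

Lemma measurable_forall_tnth (A : 'I_d -> set R) :
  (forall j, measurable (A j)) ->
  measurable [set th : d.-tuple R | forall j, A j (tnth th j)].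
Proof.
move=> mA.
rewrite (_ : [set th | _] = \bigcap_(j in [set: 'I_d]) ((@tnth d R ^~ j) @^-1` A j)); last first.
  by apply/seteqP; split=> th /= H j; [move=> _; exact: H|exact: H].
apply: fin_bigcap_measurable; first exact: finite_finset.
by move=> j _; rewrite -[X in measurable X]setTI; exact: measurable_tnth.
Qed.

Definition cube (c : d.-tuple R) (e : R) : set (d.-tuple R) :=
  [set th | forall j : 'I_d, `|tnth th j - tnth c j| < e].

Lemma measurable_cube c e : measurable (cube c e).
Proof.
apply: (@measurable_forall_tnth (fun j => [set u | `|u - tnth c j| < e])) => j.
rewrite (_ : [set _ | _] = `]tnth c j - e, tnth c j + e[%classic) //.
apply/seteqP; split=> u /=; rewrite in_itv /= ltr_norml => /andP[? ?];
by apply/andP; split; lra.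
Qed.

(* R^d is second countable: the complement of the support is covered by the
   countably many null cubes with rational centre and radius. *)
Lemma ae_supp (Q : probability (d.-tuple R) R) : {ae Q, forall th, supp d Q th}.
Proof.
pose N n : set (d.-tuple R) :=
  if unpickle n is Some (q, e) then
    let c := cube [tuple ratr (tnth q j) | j < d] (ratr e) in
    if Q c == 0%E then c else set0
  else set0.
have mN n : Q.-negligible (N n).
  rewrite /N; case: (unpickle n : option (d.-tuple rat * rat)) => [[q e]|]; last exact: negligible_set0.
  case: eqP => [Q0|_]; last exact: negligible_set0.
  by apply/negligibleP => //; exact: measurable_cube.
apply: negligibleS (negligible_bigcup mN) => th /=.
move=> /existsNP[e /not_implyP[e0 /negP]]; rewrite -leNgt => Qle.
have Qe : Q (cube th e) = 0%E by apply/eqP; rewrite eq_le Qle measure_ge0.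
have [r] := @rat_in_itvoo R 0 (e / 2) (divr_gt0 e0 (ltr0Sn _ 1)).
rewrite in_itv /= => /andP[r0 re].
have qP (j : 'I_d) : exists q : rat, `|ratr q - tnth th j| < ratr r.
  have [|q] := @rat_in_itvoo R (tnth th j - ratr r) (tnth th j + ratr r).
    by rewrite ltrBlDr -addrA ltrDl addr_gt0.
  rewrite in_itv /= => /andP[? ?]; exists q; rewrite ltr_norml; apply/andP; split; lra.
pose q := [tuple sval (cid (qP j)) | j < d].
have qE j : `|ratr (tnth q j) - tnth th j| < ratr r.
  by rewrite tnth_mktuple; exact: svalP (cid (qP j)).
exists (pickle (q, r)) => //; rewrite /N pickleK.
have sub : cube [tuple ratr (tnth q j) | j < d] (ratr r) `<=` cube th e.
  move=> th' H j; have := H j; rewrite tnth_mktuple; have := qE j.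
  by rewrite !ltr_norml => /andP[? ?] /andP[? ?]; apply/andP; split; lra.
rewrite ifT; last first.
  rewrite eq_le measure_ge0 andbT -Qe; apply: le_measure => //;
  by rewrite inE; exact: measurable_cube.
by move=> j; rewrite tnth_mktuple distrC; exact: qE.
Qed.


End MeasurableTuples.

Section Mixtures.
Context {R : realType}.
Variables (b : nat -> R) (d : nat).
Hypothesis b0 : forall k, 0 < b k.
Implicit Types (Q : probability (d.-tuple R) R) (k : d.-tuple nat) (th : d.-tuple R).

Definition psd_kernel th k : R := \prod_(j < d) fpsd b (tnth th j) (tnth k j).

Lemma measurable_Theta : measurable (Theta b d).
Proof. exact: (@measurable_forall_tnth R d (fun=> Tset b) (fun=> measurable_Tset b0)). Qed.

Lemma measurable_psd_kernel k : measurable_fun (Theta b d) (psd_kernel ^~ k).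
Proof.
apply: measurable_prod => j _.
refine (@measurable_comp _ _ _ _ _ _ (Tset b) (fpsd b ^~ (tnth k j))
  (Theta b d) (@tnth d R ^~ j) _ _ _ _).
- exact: measurable_Tset.
- by move=> _ [th T <-]; exact: T.
- exact: measurable_fpsd.
- exact: measurable_funS (measurable_tnth j).
Qed.

Lemma psd_kernel_ge0 th k : Theta b d th -> 0 <= psd_kernel th k.
Proof. by move=> T; apply: prodr_ge0 => j _; exact: fpsd_ge0. Qed.

Lemma sum_box_psd_kernel th M :
  \sum_(k <- box d M) psd_kernel th k =
  \prod_(j < d) \sum_(i < M) fpsd b (tnth th j) i.
Proof.
rewrite bigA_distr_bigA big_map big_enum /=; apply: eq_bigr => f _.
by apply: eq_bigr => j _; rewrite tnth_mktuple.
Qed.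

Lemma sum_psd_kernel_le1 th (A : seq (d.-tuple nat)) : Theta b d th -> uniq A ->
  \sum_(k <- A) psd_kernel th k <= 1.
Proof.
move=> T uA; have [M AM] := sub_box A.
have K0 k : 0 <= psd_kernel th k by exact: psd_kernel_ge0.
apply: le_trans (sum_subset_le K0 uA (box_uniq _ _) AM) _.
rewrite sum_box_psd_kernel.
have u01 (j : 'I_d) : 0 <= \sum_(i < M) fpsd b (tnth th j) i <= 1.
  by rewrite sumr_ge0 ?sum_fpsd_le1 // => i _; exact: fpsd_ge0.
by have /andP[] := prod_itv01 (index_enum 'I_d) u01.
Qed.

Section OneMixture.
Variable Q : probability (d.-tuple R) R.
Hypothesis QT : Q (Theta b d) = 1%E.

Lemma int_psd_kernel (A : seq (d.-tuple nat)) : uniq A ->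
  (0 <= \int[Q]_(th in Theta b d) (\sum_(k <- A) psd_kernel th k)%:E <= 1)%E.
Proof.
move=> uA; apply/andP; split.
  apply: integral_ge0 => th T; rewrite lee_fin sumr_ge0 // => k _.
  exact: psd_kernel_ge0.
rewrite -QT -[leRHS]mul1e -integral_cst; last exact: measurable_Theta.
apply: ge0_le_integral; first exact: measurable_Theta.
- move=> th T; rewrite lee_fin sumr_ge0 // => k _; exact: psd_kernel_ge0.
- by apply/measurable_EFinP; apply: measurable_sum => k; exact: measurable_psd_kernel.
- exact: measurable_cst.
- by move=> th T; rewrite lee_fin sum_psd_kernel_le1.
Qed.

Lemma mixpmfE k : (mixpmf b d Q k)%:E = (\int[Q]_(th in Theta b d) (psd_kernel th k)%:E)%E.
Proof.
have := @int_psd_kernel [:: k] isT.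
under eq_integral do rewrite big_seq1.
by rewrite /mixpmf /psd_kernel => /andP[i0 i1]; rewrite fineK // ge0_fin_numE // (le_lt_trans i1) ?ltry.
Qed.

Lemma sum_mixpmfE (A : seq (d.-tuple nat)) :
  (\sum_(k <- A) mixpmf b d Q k)%:E =
  (\int[Q]_(th in Theta b d) (\sum_(k <- A) psd_kernel th k)%:E)%E.
Proof.
rewrite -sumEFin; under eq_bigr do rewrite mixpmfE.
rewrite -ge0_integral_sum; last 3 first.
- exact: measurable_Theta.
- by move=> k; apply/measurable_EFinP; exact: measurable_psd_kernel.
- by move=> k th T; rewrite lee_fin; exact: psd_kernel_ge0.
by apply: eq_integral => th _; rewrite sumEFin.
Qed.

Lemma mixpmf_ge0 k : 0 <= mixpmf b d Q k.
Proof.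
rewrite -lee_fin mixpmfE; apply: integral_ge0 => th T.
by rewrite lee_fin; exact: psd_kernel_ge0.
Qed.

Lemma sum_mixpmf_le1 (A : seq (d.-tuple nat)) : uniq A ->
  \sum_(k <- A) mixpmf b d Q k <= 1.
Proof. by move=> /int_psd_kernel /andP[_]; rewrite -sum_mixpmfE lee_fin. Qed.

Lemma sum_box_mixpmf_ge (W K : nat) (t0 tht : R) : 0 < t0 < 1 ->
  (forall i, (W <= i)%N -> b i.+1 * tht <= t0 * b i) -> (W <= K)%N ->
  supp d Q `<=` [set th | forall j, 0 <= tnth th j <= tht] ->
  1 - \sum_(k <- box d K) mixpmf b d Q k <= d%:R * (t0 ^+ (K - W) / (1 - t0)).
Proof.
move=> t01 ratio WK supQ; set eps := t0 ^+ (K - W) / (1 - t0).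
rewrite lerBlDr -lerBlDl; have [neg|pos] := leP (1 - d%:R * eps) 0.
  by rewrite (le_trans neg) // sumr_ge0 // => k _; exact: mixpmf_ge0.
rewrite -lee_fin sum_mixpmfE -[leLHS]mule1 -QT -integral_cst; last exact: measurable_Theta.
apply: ae_ge0_le_integral; first exact: measurable_Theta.
- by move=> th _; rewrite lee_fin ltW.
- exact: measurable_cst.
- move=> th T; rewrite lee_fin sumr_ge0 // => k _; exact: psd_kernel_ge0.
- by apply/measurable_EFinP; apply: measurable_sum => k; exact: measurable_psd_kernel.
apply: filterS (ae_supp Q) => th /supQ /= thle T; rewrite lee_fin sum_box_psd_kernel.
pose u (j : 'I_d) := \sum_(i < K) fpsd b (tnth th j) i.
apply: le_trans (@prod_ge_1Bsum R _ (index_enum 'I_d) u _); last first.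
  by move=> j; rewrite sumr_ge0 ?sum_fpsd_le1 // => i _; exact: fpsd_ge0.
rewrite lerD2l lerN2 (_ : d%:R * eps = \sum_(j < d) eps); last first.
  by rewrite sumr_const card_ord mulr_natl.
apply: ler_sum => j _; apply: fpsd_tail ratio WK _ _ => //.
by have /andP[] := thle j.
Qed.

End OneMixture.

Section Midpoint.
Variables Q1 Q2 : probability (d.-tuple R) R.

Definition midpoint : set (d.-tuple R) -> \bar R :=
  mscale (2^-1)%:nng (measure_add Q1 Q2).

HB.instance Definition _ := Measure.on midpoint.

Lemma midpointE A : midpoint A = (2^-1%:E * (Q1 A + Q2 A))%E.
Proof. by rewrite /midpoint /mscale -[X in (_ * X)%E]/(measure_add Q1 Q2 A) measure_addE. Qed.

Lemma midpoint_setT : midpoint setT = 1%E.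
Proof. by rewrite midpointE !probability_setT -EFinD -EFinM mulVf. Qed.

HB.instance Definition _ := Measure_isProbability.Build _ _ _ midpoint midpoint_setT.

Hypothesis Q1T : Q1 (Theta b d) = 1%E.
Hypothesis Q2T : Q2 (Theta b d) = 1%E.

Lemma midpoint_Theta : midpoint (Theta b d) = 1%E.
Proof. by rewrite midpointE Q1T Q2T -EFinD -EFinM mulVf. Qed.

Lemma mixpmf_midpoint k :
  mixpmf b d midpoint k = (mixpmf b d Q1 k + mixpmf b d Q2 k) / 2.
Proof.
apply: EFin_inj; rewrite mixpmfE; last exact: midpoint_Theta.
have mT := measurable_Theta.
have mK : measurable_fun (Theta b d) (fun th => (psd_kernel th k)%:E).
  by apply/measurable_EFinP; exact: measurable_psd_kernel.
have K0 th : Theta b d th -> (0 <= (psd_kernel th k)%:E)%E.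
  by move=> T; rewrite lee_fin; exact: psd_kernel_ge0.
rewrite [LHS](ge0_integral_mscale (measure_add Q1 Q2) mT (2^-1)%:nng mK K0).
rewrite ge0_integral_measure_add //.
by rewrite -(mixpmfE Q1T) -(mixpmfE Q2T) -EFinD -EFinM mulrC.
Qed.

End Midpoint.

(* Comparing the NPMLE with its midpoint with the truth and using
   [y <= exp (y - 1)] replaces the usual directional derivative argument. *)
Lemma npmle_score_ge0 n (x : n.-tuple (d.-tuple nat)) Qhat Q0 :
  Q0 (Theta b d) = 1%E -> is_npmle b d n x Qhat ->
  (forall i, 0 < mixpmf b d Q0 (tnth x i)) ->
  0 <= \sum_(i < n) (mixpmf b d Qhat (tnth x i) - mixpmf b d Q0 (tnth x i)) /
                    (mixpmf b d Qhat (tnth x i) + mixpmf b d Q0 (tnth x i)).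
Proof.
move=> Q0T [QhT Qmax] c0.
pose a i := mixpmf b d Qhat (tnth x i); pose c i := mixpmf b d Q0 (tnth x i).
have a0 i : 0 <= a i by exact: mixpmf_ge0.
have ac0 i : 0 < a i + c i := ltr_wpDl (a0 i) (c0 i).
have mid0 : 0 < \prod_(i < n) ((a i + c i) / 2).
  by apply: prodr_gt0 => i _; rewrite divr_gt0.
have lemid : \prod_(i < n) ((a i + c i) / 2) <= \prod_(i < n) a i.
  have := Qmax (midpoint Qhat Q0) (midpoint_Theta QhT Q0T).
  rewrite /lik; under eq_bigr do rewrite (mixpmf_midpoint QhT Q0T).
  by [].
have prod1 : 1 <= \prod_(i < n) (a i / ((a i + c i) / 2)).
  by rewrite big_split /= prodfV ler_pdivlMr // mul1r.
rewrite -(@ler_expR R) exp.expR0; apply: le_trans prod1 _.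
rewrite expR_sum; apply: ler_prod => i _.
apply/andP; split; first by rewrite !divr_ge0 // ltW.
apply: le_trans (expR_ge1Dx _).
rewrite (_ : a i / _ = 1 + (a i - c i) / (a i + c i)) //.
by field; rewrite gt_eqF.
Qed.

End Mixtures.

Section Constants.
Context {R : realType}.
Variables (b : nat -> R) (d : nat) (Q0 : probability (d.-tuple R) R) (q0 M : R).
Hypothesis b0 : forall k, 0 < b k.
Hypothesis r0 : (0 < conv_radius b)%E.
Hypothesis hA1 : A1 b d Q0 q0 M.

Lemma t0c_bounds : 2^-1 <= t0c b q0 < 1.
Proof.
move: hA1; rewrite /A1 /t0c; case: (conv_radius b) => [r [/andP[? ?] _]|_|//].
  by apply/andP; split; lra.
by apply/andP; split; lra.
Qed.

Lemma thtc_gt0 : 0 < thtc b q0 M.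
Proof.
move: hA1 r0; rewrite /A1 /thtc.
case: (conv_radius b) => [r [/andP[? ?] _]|[? _]|//] //.
by rewrite lte_fin => ?; rewrite mulr_gt0.
Qed.

Lemma supp_thtc :
  supp d Q0 `<=` [set th | forall j, 0 <= tnth th j <= thtc b q0 M].
Proof.
by move: hA1; rewrite /A1 /thtc; case: (conv_radius b) => [r [_ ?]|[_ ?]|//].
Qed.

Lemma ratio_limit_lt (l : R) : (fun k => b k.+1 / b k) @ \oo --> l ->
  l < t0c b q0 / thtc b q0 M.
Proof.
move=> bl; rewrite ltr_pdivlMr ?thtc_gt0 //.
have lT th : Tset b th -> l * th <= 1 by exact: ratio_limit_le.
have sup_gt (y : R) : (y%:E < conv_radius b)%E -> exists2 th, Tset b th & y < th.
  by move=> /ereal_sup_gt[_ [th T <-]]; rewrite lte_fin => ?; exists th.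
move: hA1 r0 sup_gt; rewrite /A1 /t0c /thtc.
case: (conv_radius b) => [r [/andP[q00 q01] _]|[M0 _] _|//].
  rewrite lte_fin => rp sup_gt.
  have lr : l * r <= 1.
    rewrite leNgt; apply/negP => lr.
    have l0 : 0 < l by rewrite -(pmulr_lgt0 _ rp) (lt_trans ltr01).
    have [|th T] := sup_gt l^-1; first by rewrite lte_fin -[l^-1]mul1r ltr_pdivrMr // mulrC.
    by rewrite -[l^-1]mul1r ltr_pdivrMr // mulrC ltNge lT.
  by rewrite mulrCA; nra.
move=> sup_gt; have [th T Mth] := sup_gt (2 * M) (ltry _).
by have := lT _ T; nra.
Qed.

End Constants.

Lemma hellinger_gt_finite {R : realType} (d : nat) (p1 p2 : d.-tuple nat -> R) (c : R) :
  0 <= c -> c < hellinger d p1 p2 ->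
  exists2 G : seq (d.-tuple nat), uniq G &
    c ^+ 2 <= 2^-1 * \sum_(k <- G) (Num.sqrt (p1 k) - Num.sqrt (p2 k)) ^+ 2.
Proof.
rewrite /hellinger => c0; set e := esum _ _ => ch.
have e0 : (0 <= e)%E by apply: esum_ge0 => k _; rewrite lee_fin sqr_ge0.
have ce : ((2 * c ^+ 2)%:E < e)%E.
  move: ch e0; case: e => [e ch _||//]; last first.
    by rewrite mulry gtr0_sg ?invr_gt0 // mul1e /= sqrtr0 ltNge c0.
  have ce : c ^+ 2 < 2^-1 * e.
    have he : 0 < 2^-1 * e by rewrite -sqrtr_gt0 (le_lt_trans c0 ch).
    rewrite -(sqr_sqrtr (ltW he)) ltrXn2r // ?nnegrE ?sqrtr_ge0 //.
  by rewrite lte_fin; lra.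
have [_ [F [finF _] <-]] := ereal_sup_gt ce.
rewrite fsbig_finite // sumEFin lte_fin => cF.
exists (finmap.enum_fset (fset_set F)); first exact: finmap.fset_uniq.
lra.
Qed.

Lemma rate_arith {R : realType} (d n K : nat) (L l lam : R) :
  (0 < n)%N -> 2 < L -> 0 < lam -> 3 * lam <= 2 * l -> K%:R <= 2 * l / lam + 1 ->
  (2 * (K ^ d)%:R / n%:R + 4 * (2 / n%:R)) / (L * l `^ (1 + d%:R / 2) / Num.sqrt n%:R) ^+ 2 <=
  5 / L * (3 ^+ d / lam `^ (1 + d%:R / 2)) * (1 / lam `^ (1 + d%:R / 2)).
Proof.
move=> n0 L2 lam0 lamle Kle.
have l0 : 0 < l by lra.
have nn : 0 < n%:R :> R by rewrite ltr0n.
have pow2 (a : R) : 0 < a -> (a `^ (1 + d%:R / 2)) ^+ 2 = a ^+ (d + 2).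
  move=> a0; rewrite -powR_mulrn ?powR_ge0 // -powRrM -powR_mulrn ?ltW //.
  by congr (_ `^ _); rewrite natrD; field.
rewrite !exprMn exprVn pow2 // sqr_sqrtr ?ler0n //.
have -> : 5 / L * (3 ^+ d / lam `^ (1 + d%:R / 2)) * (1 / lam `^ (1 + d%:R / 2)) =
    5 * 3 ^+ d / (L * lam ^+ (d + 2)).
  have lp : lam `^ (1 + d%:R / 2) != 0 by rewrite gt_eqF // powR_gt0.
  by rewrite -pow2 //; field; rewrite lp gt_eqF //; lra.
set P := (K ^ d)%:R.
have -> : (2 * P / n%:R + 4 * (2 / n%:R)) / (L ^+ 2 * l ^+ (d + 2) / n%:R) =
    (2 * P + 8) / (L ^+ 2 * l ^+ (d + 2)).
  have ld : l ^+ (d + 2) != 0 by rewrite gt_eqF // exprn_gt0.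
  by field; rewrite ld !gt_eqF //; lra.
set rho := l / lam.
have rho1 : 1 <= rho by rewrite ler_pdivlMr //; lra.
have lE : l = rho * lam by rewrite /rho divfK // gt_eqF.
have K3 : K%:R <= 3 * rho by move: Kle; rewrite -mulrA -/rho; lra.
have PE : P <= 3 ^+ d * rho ^+ (d + 2).
  rewrite /P natrX; apply: (@le_trans _ _ ((3 * rho) ^+ d)).
    by rewrite lerXn2r ?nnegrE ?ler0n //; lra.
  by rewrite exprMn ler_wpM2l ?exprn_ge0 // ler_weXn2l // leq_addr.
have A1 : 1 <= 3 ^+ d * rho ^+ (d + 2).
  by rewrite -[1]mul1r ler_pM // exprn_ege1 //; lra.
rewrite lE exprMn; set S := rho ^+ (d + 2) in PE A1 *; set D := lam ^+ (d + 2).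
set Q := 3 ^+ d in PE A1 *.
have S0 : 0 < S by rewrite exprn_gt0 //; lra.
have D0 : 0 < D by rewrite exprn_gt0.
rewrite ler_pdivrMr; last by rewrite !mulr_gt0 //; lra.
rewrite (_ : _ * (L ^+ 2 * _) = 5 * (Q * S) * L); last by field; rewrite !gt_eqF //; lra.
by nra.
Qed.

Section NcBound.
Context {R : realType}.
Variables (b : nat -> R) (d V : nat) (t0 tht delta0 eta0 : R) (n : nat).
Hypothesis d0 : (0 < d)%N.
Hypothesis t0b : 2^-1 <= t0 < 1.
Hypothesis Ncn : Nc b d V t0 tht delta0 eta0 <= n%:Z.

Local Notation W := (Wc b t0 tht).

Lemma Nc_lt : d%:R^-1 * expR (ln (1 / Num.sqrt t0) * W%:R) < n%:R /\
  1 / (t0 ^+ (W - 1) * (1 - t0)) < n%:R.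
Proof.
have t0p : 0 < t0 by have /andP[? ?] := t0b; lra.
have lam0 : 0 <= ln (1 / Num.sqrt t0).
  apply: ln_ge0; rewrite ler_pdivlMr ?sqrtr_gt0 // mul1r.
  by rewrite -sqrtr1 ler_sqrt //; have /andP[_ /ltW] := t0b.
move: Ncn; rewrite /Nc; set m := Num.max _ (1 / (_ * _)) => Nn.
have mn : m < n%:R.
  apply: lt_le_trans (_ : (Num.floor m + 1)%:~R <= _); first exact: floorD1_gt.
  by rewrite -[n%:R]/(n%:Z%:~R) ler_int.
split; apply: le_lt_trans mn; rewrite le_max ?lexx ?orbT //.
rewrite ler_pM2l ?invr_gt0 ?ltr0n // ler_expR ler_wpM2l //.
by rewrite !le_max lexx !orbT.
Qed.

Lemma Nc_log : 0 < ln (1 / t0) /\ (0 < n)%N /\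
  ln (1 / t0) * W%:R <= 2 * ln (n * d)%N%:R.
Proof.
have /andP[t0h t01] := t0b.
have t0p : 0 < t0 by rewrite (lt_le_trans _ t0h) ?invr_gt0.
have [E _] := Nc_lt.
have n0 : (0 < n)%N.
  rewrite -(ltr_nat R); apply: le_lt_trans E.
  by rewrite mulr_ge0 ?invr_ge0 ?expR_ge0.
split; first by apply: ln_gt0; rewrite ltr_pdivlMr // mul1r.
split=> //.
have -> : ln (1 / t0) = 2 * ln (1 / Num.sqrt t0).
  rewrite mulr_natl -lnXn ?divr_gt0 ?sqrtr_gt0 //.
  by rewrite expr_div_n expr1n sqr_sqrtr // ltW.
rewrite -mulrA ler_pM2l // -ler_expR lnK ?posrE ?ltr0n ?muln_gt0 ?n0 //.
by rewrite natrM -ler_pdivrMr ?ltr0n // mulrC ltW.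
Qed.

Lemma Nc_tail (K : nat) : (W <= K)%N -> (1 <= W)%N ->
  2 * ln (n * d)%N%:R / ln (1 / t0) <= K%:R ->
  d%:R * (t0 ^+ (K - W) / (1 - t0)) <= 2 / n%:R.
Proof.
move=> WK W1 Kge; have /andP[t0h t01] := t0b.
have t0p : 0 < t0 by rewrite (lt_le_trans _ t0h) ?invr_gt0.
have [_ E] := Nc_lt; have [lam0 [n0 _]] := Nc_log.
have nd0 : 0 < (n * d)%N%:R :> R by rewrite ltr0n muln_gt0 n0.
have t0K : t0 ^+ K <= (n * d)%N%:R ^- 2.
  have -> : t0 = expR (- ln (1 / t0)).
    by rewrite expRN lnK ?posrE ?divr_gt0 // div1r invrK.
  rewrite -expRM_natl -[_%:R in leRHS](@lnK R) ?posrE //.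
  rewrite -expRM_natl -expRN ler_expR mulrN lerN2.
  by rewrite ler_pdivrMr // in Kge; rewrite lnK.
have n0R : 0 < n%:R :> R by rewrite ltr0n.
have d0R : 1 <= d%:R :> R by rewrite ler1n.
have t0V : t0^-1 <= 2 by rewrite -[leRHS]invrK lef_pV2 ?posrE ?invr_gt0.
have tK : t0 ^+ (K - W) = t0 ^+ K / (t0 * t0 ^+ (W - 1)).
  by rewrite -exprS subn1 prednK // expfB_cond ?gt_eqF // WK.
have tWp : 0 < t0 ^+ (W - 1) by rewrite exprn_gt0.
have tKp : 0 <= t0 ^+ K by rewrite exprn_ge0 // ltW.
rewrite tK; move: E tWp tKp t0K; move: (t0 ^+ (W - 1)) (t0 ^+ K) => u v E u0 v0 vle.
have -> : d%:R * (v / (t0 * u) / (1 - t0)) = d%:R / t0 * v * (1 / (u * (1 - t0))).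
  by field; rewrite !gt_eqF // subr_gt0.
apply: (@le_trans _ _ (d%:R * 2 * (n * d)%N%:R ^- 2 * n%:R)).
  apply: ler_pM; rewrite ?(ltW E) //.
  - by rewrite !mulr_ge0 ?invr_ge0 ?(ltW t0p).
  - by rewrite divr_ge0 // mulr_ge0 ?(ltW u0) // subr_ge0 ltW.
  apply: ler_pM => //; rewrite ?divr_ge0 ?(ltW t0p) //.
  by apply: ler_wpM2l => //; rewrite (le_trans ler01).
rewrite (_ : _ * n%:R = 2 / n%:R * d%:R^-1); last first.
  have [xn yn] : n%:R != 0 :> R /\ d%:R != 0 :> R.
    by split; rewrite gt_eqF // (lt_le_trans ltr01).
  rewrite natrM.
  move: (n%:R : R) (d%:R : R) xn yn => x y xn yn.
  by field; rewrite xn yn.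
by rewrite ler_piMr ?divr_ge0 // invf_le1 // (lt_le_trans ltr01).
Qed.

End NcBound.

Theorem theorem1 :
  exists C : RR, 0 < C /\
  forall (b : nat -> RR) (d : nat) (Q0 : probability (d.-tuple RR) RR)
         (q0 M delta0 eta0 : RR) (V : nat) (L : RR) (n : nat),
    (forall k, 0 < b k) ->
    (0 < conv_radius b)%E ->
    (1 <= d)%N ->
    Q0 (Theta b d) = 1%E ->
    A1 b d Q0 q0 M -> A2 b d Q0 delta0 eta0 -> A3 b V -> A4 b ->
    2 < L ->
    Nc b d V (t0c b q0) (thtc b q0 M) delta0 eta0 <= n%:Z ->
    forall Qhat : n.-tuple (d.-tuple nat) -> probability (d.-tuple RR) RR,
      (forall x, is_npmle b d n x (Qhat x)) ->
      (Psample d n (mixpmf b d Q0)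
         [set x | (hellinger d (mixpmf b d (Qhat x)) (mixpmf b d Q0) >
                  L * ((ln (n * d)%N%:R) `^ (1 + d%:R / 2)) / Num.sqrt n%:R)%R]
       <= EFin (1 / ((L ^+ 2 / 2 - 2) ^+ 2 * (ln (n * d)%N%:R) `^ (2 + d%:R))
           + C / L * (d%:R * 3 ^+ d / (ln (1 / t0c b q0)) `^ (1 + d%:R / 2))
               * (1 + 1 / (ln (1 / t0c b q0)) `^ (1 + d%:R / 2)))%R)%E.
Proof.
exists 5; split=> // b d Q0 q0 M delta0 eta0 V L n b0 r0 d0 Q0T hA1 _ _ [lr hA4] L2 Nn Qhat npmle.
set t0 := t0c b q0; set tht := thtc b q0 M.
have t0b : 2^-1 <= t0 < 1 := t0c_bounds hA1.
have tht0 : 0 < tht := thtc_gt0 r0 hA1.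
have /andP[t0h t01] := t0b.
have t0p : 0 < t0 by rewrite (lt_le_trans _ t0h) ?invr_gt0.
have [W3 ratio] := WcP b0 t0p tht0 hA4 (ratio_limit_lt b0 r0 hA1 hA4).
have [lam0 [n0 logW]] := Nc_log d0 t0b Nn.
set W := Wc b t0 tht in W3 ratio logW; set lam := ln (1 / t0) in lam0 logW *.
set l := ln (n * d)%N%:R in logW *.
have W3R : 3 <= W%:R :> RR by rewrite ler_nat.
have lge : 3 * lam <= 2 * l by apply: le_trans logW; rewrite mulrC ler_pM2l.
have l0 : 0 < l by lra.
have q0' : 0 <= 2 * l / lam by rewrite divr_ge0 ?mulr_ge0 ?ltW.
pose K := (Num.truncn (2 * l / lam)).+1.
have /andP[Kle Kgt] := truncn_itv q0'.
have WK : (W <= K)%N.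
  rewrite -(ler_nat RR) (le_trans _ (ltW Kgt)) // ler_pdivlMr //.
  by rewrite mulrC.
have tail : 1 - \sum_(k <- box d K) mixpmf b d Q0 k <= 2 / n%:R.
  apply: le_trans (Nc_tail d0 t0b Nn WK (ltnW (ltnW W3)) (ltW Kgt)).
  apply: (sum_box_mixpmf_ge b0 Q0T _ ratio WK (supp_thtc hA1)).
  by rewrite t0p.
set thr := L * _ / _.
have nR : 0 < Num.sqrt n%:R :> RR by rewrite sqrtr_gt0 ltr0n.
have thr0 : 0 < thr by rewrite divr_gt0 // mulr_gt0 ?powR_gt0 //; lra.
have thr2 : 0 < thr ^+ 2 by rewrite exprn_gt0.
apply: le_trans (deviation_markov n0 (mixpmf_ge0 b0 Q0T) (sum_mixpmf_le1 b0 Q0T)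
  (box_uniq d K) thr2 _) _.
  move=> x /= hx px.
  have [G uG thrG] := hellinger_gt_finite (ltW thr0) hx.
  apply: le_trans thrG (hellinger_le_deviation n0 _ _ _ _ _ _ _ uG) => //.
  - exact: mixpmf_ge0.
  - by apply: mixpmf_ge0 => //; have [] := npmle x.
  - by move=> A uA; apply: sum_mixpmf_le1.
  - by move=> A uA; apply: sum_mixpmf_le1 => //; have [] := npmle x.
  - exact: box_uniq.
  - exact: npmle_score_ge0.
rewrite lee_fin size_box.
have Kle' : K%:R <= 2 * l / lam + 1 by rewrite /K -natr1 lerD2r.
apply: le_trans (le_trans _ (rate_arith d n0 L2 lam0 lge Kle')) _.
  rewrite ler_pdivrMr // divfK ?gt_eqF //.
  by rewrite lerD2l ler_wpM2l.
have p0 : 0 < lam `^ (1 + d%:R / 2) by rewrite powR_gt0.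
have A0 : 0 <= 5 / L by rewrite divr_ge0 // (le_trans _ (ltW L2)).
apply: ler_wpDl.
  by rewrite divr_ge0 // mulr_ge0 ?sqr_ge0 ?powR_ge0.
have T0 : 0 <= 3 ^+ d / lam `^ (1 + d%:R / 2) :> RR.
  by rewrite divr_ge0 ?exprn_ge0 ?powR_ge0.
apply: ler_pM.
- exact: mulr_ge0.
- by rewrite divr_ge0 ?powR_ge0.
- by rewrite -[d%:R * _ / _]mulrA ler_wpM2l // ler_peMl // ler1n.
- by rewrite lerDr.
Qed.
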